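(* Let $\mathcal{A}:\mathbb{R}^{m\times n}\to\mathbb{R}^p$ be a linear map with $\|\mathcal{A}^*b\|_2>0$ for the given $b\in\mathbb{R}^p$, let $\lambda>0$, and let $f_\lambda(X):=\lambda\|X\|_*+\frac12\|\mathcal{A}X-b\|^2$ for $X\in\mathbb{R}^{m\times n}$. Let $k_0<k_1<k_2<\cdots$ be the indices at which a proximal gradient step is executed in the proximal generation method (described in the context), and let $\{X^{k_i}_+\}$ be the sequence generated by these proximal gradient steps, $X^{k_i}_+=\operatorname{PG}_\lambda(X^{k_i})$. Then $$f_\lambda(X^{k_i})-f_\lambda(X^* )=O\left(\frac1i\right),\qquad\forall X^*\in\operatorname{argmin} f_\lambda(X),$$ and any limiting point of $\{X^{k_i}_+\}$ is a solution of $\min_{X\in\mathbb{R}^{m\times n}}f_\lambda(X)$.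
   Context: $\|\cdot\|_*$ is the nuclear norm, $\|\cdot\|_2$ is the spectral norm of a matrix, and $\|\cdot\|$ is the Euclidean norm for vectors and Frobenius norm for matrices. $L_{\mathcal{A}^*\mathcal{A}}$ is the Lipschitz constant of the gradient of $X\mapsto\frac12\|\mathcal{A}X-b\|^2$. With $\operatorname{prox}_{f}(Z)=\operatorname{argmin}_X f(X)+\frac12\|X-Z\|^2$, the proximal gradient map is $$\operatorname{PG}_\lambda(X):=\operatorname{prox}_{(\lambda/L_{\mathcal{A}^*\mathcal{A}})\|\cdot\|_*}\Big(X-\tfrac1{L_{\mathcal{A}^*\mathcal{A}}}\mathcal{A}^*(\mathcal{A}X-b)\Big).$$ For $L\in\mathbb{R}^{m\times r}$, $R\in\mathbb{R}^{n\times r}$, let $g_\lambda(L,R):=\frac\lambda2(\|L\|^2+\|R\|^2)+\frac12\|\mathcal{A}(LR^T)-b\|^2$. For a matrix $X$ with singular value decomposition $X=U_X\Sigma_XV_X^T$, let $\operatorname{LR-SVD}(X)=(U_X\sqrt{\Sigma_X},V_X\sqrt{\Sigma_X})$ (the number $r$ of columns may differ from one call to the next). Proximal generation method. Input: $X^0\in\mathbb{R}^{m\times n}$, a tolerance $\varepsilon_{L,R}>0$, and a positive integer $k_{\text{check}}$. Step 0: compute $X^0_+=\operatorname{PG}_\lambda(X^0)$, set $(L^1,R^1)=\operatorname{LR-SVD}(X^0_+)$ and $k=1$ (so $k_0=0$). Then repeat: (a) alternating minimization: $L^{k+1}=\operatorname{argmin}_L g_\lambda(L,R^k)$, then $R^{k+1}=\operatorname{argmin}_R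 g_\lambda(L^{k+1},R)$; set $k\leftarrow k+1$. (b) If $k$ is divisible by $k_{\text{check}}$ or $\|\nabla g_\lambda(L^k,R^k)\|\leqslant\varepsilon_{L,R}$: set $X^k=L^k(R^k)^T$, compute the proximal gradient step $X^k_+=\operatorname{PG}_\lambda(X^k)$, set $(L^{k+1},R^{k+1})=\operatorname{LR-SVD}(X^k_+)$, and set $k\leftarrow k+1$. The index $k$ at which $X^k_+$ is computed is one of the $k_i$. *)

(* Defs.v *)
From HB Require Import structures.
From mathcomp Require Import all_boot all_order all_algebra.
From mathcomp Require Import all_classical all_reals all_analysis.
Import Order.TTheory GRing.Theory Num.Theory.
Import numFieldNormedType.Exports.

Set Implicit Arguments.
Unset Strict Implicit.
Unset Printing Implicit Defensive.

Local Open Scope ring_scope.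
Local Open Scope classical_set_scope.

Definition argmin (R : realType) (T : Type) (f : T -> R) : set T :=
  [set x | forall y, f x <= f y].

Section MatrixNorms.
Variable R : realType.

Definition mxdot m n (X Y : 'M[R]_(m, n)) : R := \tr (X^T *m Y).

(* Frobenius norm; on column vectors, the Euclidean norm. The norm `|X| that
   MathComp-Analysis puts on matrices is the max norm. *)
Definition frob m n (X : 'M[R]_(m, n)) : R := Num.sqrt (mxdot X X).

Definition spectral_norm m n (X : 'M[R]_(m, n)) : R :=
  sup [set frob (X *m v) | v in [set v : 'cV[R]_n | frob v <= 1]].

(* Singular value decomposition X = U Sigma V^T with Sigma = diag_mx s of any
   size r for which one exists. Zero singular values are allowed and no order is
   imposed on them, so both the compact (r = rank X) and the thin
   (r = min(m, n)) decompositions are covered. *)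
Definition is_svd m n r (X : 'M[R]_(m, n))
    (U : 'M[R]_(m, r)) (s : 'rV[R]_r) (V : 'M[R]_(n, r)) : Prop :=
  [/\ U^T *m U = 1%:M, V^T *m V = 1%:M,
      forall i, 0 <= s 0 i & X = U *m diag_mx s *m V^T].

(* Sum of the singular values. Every real matrix has a singular value
   decomposition and the sum does not depend on which one is taken, so the set
   is a singleton. *)
Definition nuclear_norm m n (X : 'M[R]_(m, n)) : R :=
  xget 0 [set t | exists r U (s : 'rV[R]_r) V,
                    is_svd X U s V /\ t = \sum_i s 0 i].

Definition grad m n (f : 'M[R]_(m, n) -> R) (X : 'M[R]_(m, n)) : 'M[R]_(m, n) :=
  \matrix_(i, j) 'D_(delta_mx i j) f X.

Definition lipschitz_const m n (G : 'M[R]_(m, n) -> 'M[R]_(m, n)) : R :=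
  inf [set c : R | 0 <= c /\ forall X Y, frob (G X - G Y) <= c * frob (X - Y)].

Definition prox m n (f : 'M[R]_(m, n) -> R) (Z : 'M[R]_(m, n)) :
    set 'M[R]_(m, n) :=
  argmin (fun X => f X + 2^-1 * frob (X - Z) ^+ 2).

End MatrixNorms.

Section LeastSquares.
Variables (R : realType) (m n p : nat).
Variables (A : {linear 'M[R]_(m, n) -> 'cV[R]_p}) (b : 'cV[R]_p) (lam : R).

Definition adjoint (y : 'cV[R]_p) : 'M[R]_(m, n) :=
  \matrix_(i, j) mxdot (A (delta_mx i j)) y.

Lemma adjointP X y : mxdot (A X) y = mxdot X (adjoint y).
Proof.
have -> : mxdot X (adjoint y) = \sum_i \sum_j X i j * adjoint y i j.
  rewrite exchange_big /=; apply: eq_bigr => j _; rewrite mxE.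
  by apply: eq_bigr => i _; rewrite mxE.
rewrite {1}[X]matrix_sum_delta linear_sum /mxdot linear_sum mulmx_suml.
rewrite linear_sum; apply: eq_bigr => i _ /=.
rewrite linear_sum linear_sum mulmx_suml linear_sum; apply: eq_bigr => j _ /=.
by rewrite !linearZ /= -scalemxAl linearZ /= mxE.
Qed.

Definition least_squares (X : 'M[R]_(m, n)) : R := 2^-1 * frob (A X - b) ^+ 2.

Definition L_AA : R := lipschitz_const (grad least_squares).

Definition f_lam (X : 'M[R]_(m, n)) : R :=
  lam * nuclear_norm X + least_squares X.

(* The set of values of the proximal gradient map at X, a singleton by strong
   convexity of the minimized function. *)
Definition PG (X : 'M[R]_(m, n)) : set 'M[R]_(m, n) :=
  prox (fun W => lam / L_AA * nuclear_norm W)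
       (X - L_AA^-1 *: adjoint (A X - b)).

Definition g_lam r (L : 'M[R]_(m, r)) (Q : 'M[R]_(n, r)) : R :=
  lam / 2 * (frob L ^+ 2 + frob Q ^+ 2) + least_squares (L *m Q^T).

(* Norm of the gradient of g_lam with respect to the pair (L, Q). *)
Definition grad_g_norm r (L : 'M[R]_(m, r)) (Q : 'M[R]_(n, r)) : R :=
  Num.sqrt (frob (grad (fun W => g_lam W Q) L) ^+ 2
          + frob (grad (fun W => g_lam L W) Q) ^+ 2).

(* The number of columns of the factors may change along the method. *)
Record factors := Factors {
  ncols : nat;
  lfac : 'M[R]_(m, ncols);
  rfac : 'M[R]_(n, ncols) }.

Definition lr_svd (X : 'M[R]_(m, n)) : set factors :=
  [set F | exists r U (s : 'rV[R]_r) V, is_svd X U s V /\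
     F = Factors (U *m diag_mx (map_mx Num.sqrt s))
                 (V *m diag_mx (map_mx Num.sqrt s))].

Variant alt_min : factors -> factors -> Prop :=
  AltMin r (L L' : 'M[R]_(m, r)) (Q Q' : 'M[R]_(n, r)) of
      argmin (fun W => g_lam W Q) L' & argmin (fun W => g_lam L' W) Q' :
    alt_min (Factors L Q) (Factors L' Q').

Section Method.
Variables (X0 : 'M[R]_(m, n)) (eps : R) (kcheck : nat) (F : nat -> factors).

(* F k stands for (L^k, R^k), which exists for k >= 1 only: F 0 is junk. *)
Definition iterate (k : nat) : 'M[R]_(m, n) :=
  if k is 0%N then X0 else lfac (F k) *m (rfac (F k))^T.

(* Whether a proximal gradient step is executed at index k. The test is made
   only on pairs (L^k, R^k) produced by alternating minimization, i.e. when no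
   proximal gradient step took place at index k - 1: after such a step the loop
   goes straight back to alternating minimization. *)
Fixpoint prox_step (k : nat) : bool :=
  if k is k'.+1 then
    ~~ prox_step k' &&
    ((kcheck %| k)%N || (grad_g_norm (lfac (F k)) (rfac (F k)) <= eps))
  else true.

(* Xp k stands for X^k_+, which exists only if prox_step k: the other values of
   Xp are junk. *)
Record proximal_generation (Xp : nat -> 'M[R]_(m, n)) : Prop := {
  pgm_prox : forall k, prox_step k ->
    PG (iterate k) (Xp k) /\ lr_svd (Xp k) (F k.+1);
  pgm_altmin : forall k, ~~ prox_step k -> alt_min (F k) (F k.+1) }.

Definition increasing_enum (P : pred nat) (k : nat -> nat) : Prop :=
  {homo k : i j / (i < j)%N} /\ range k = [set j | P j].

Lemma prox_step_unbounded N :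
  (0 < kcheck)%N -> exists j, (N <= j)%N && prox_step j.
Proof.
move=> kc0; set M := (kcheck * N.+1)%N.
have NM : (N < M)%N by rewrite /M leq_pmull.
have M0 : (0 < M)%N by apply: leq_ltn_trans NM.
case E : (prox_step M.-1); first by exists M.-1; rewrite E andbT -ltnS prednK.
exists M; rewrite (ltnW NM) -(prednK M0) /= E prednK //.
by rewrite /M dvdn_mulr.
Qed.

Lemma prox_step_enum :
  (0 < kcheck)%N -> exists k, increasing_enum prox_step k.
Proof.
move=> kc0; have ex N := prox_step_unbounded N kc0.
pose k := fix k i := if i is i'.+1 then ex_minn (ex (k i').+1) else 0%N.
have kS i : (k i < k i.+1)%N /\ prox_step (k i.+1).
  by rewrite /=; case: ex_minnP => j /andP[].
have kP i : prox_step (k i) by case: i => // i; case: (kS i).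
have kmono : {homo k : i j / (i < j)%N}.
  by apply: homo_ltn => [? ? ?|i]; [exact: ltn_trans|case: (kS i)].
exists k; split=> //; apply/seteqP; split=> [_ [i _ <-]|j /= Pj]; first exact: kP.
have kge i : (i <= k i)%N.
  by elim: i => // i IH; apply: leq_ltn_trans IH _; case: (kS i).
have [|i ji] := @ex_minnP (fun i => j <= k i)%N.
  by exists j; exact: kge.
move=> imin; exists i => //; apply/eqP; rewrite eqn_leq ji andbT.
case: i imin ji => [//|i] imin ji.
have ij : (k i < j)%N.
  by rewrite ltnNge; apply/negP => /imin; rewrite ltnn.
by rewrite /=; case: ex_minnP => l _; apply; rewrite ij.
Qed.

End Method.
End LeastSquares.

(* Main.v *)
(* The nuclear norm is the maximum of <U V^T, X> over all U, V with
   orthonormal columns, which makes f_lam convex with a subgradient at every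
   point, and AM-GM gives nuclear_norm (L Q^T) <= (|L|^2 + |Q|^2) / 2 with
   equality at LR-SVD factors. So f_lam (L Q^T) <= g_lam L Q with equality
   after LR-SVD, and the alternating minimization steps between two proximal
   gradient steps cannot increase the objective: f(X^{k_{i+1}}) <=
   f(X^{k_i}_+). The descent lemma yields f(X_+) <= f(Z) + L/2 |Z - X|^2 for
   all Z; taking Z = (1 - t) X + t W, for an arbitrary W, and using that the
   iterates stay in a bounded sublevel set, d_i := f(X^{k_i}) - f(W) satisfies
   d_{i+1} <= (1 - t) d_i + C t^2 for all t in [0, 1], whence d_i = O(1/i) as
   for the Frank-Wolfe method. Since W is arbitrary, this also settles the
   limit points, without assuming that a minimizer exists. *)
Require Import Defs.
From mathcomp Require Import all_boot all_order all_algebra.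
From mathcomp Require Import all_classical all_reals all_analysis.
From mathcomp Require Import zify ring lra.
Import Order.TTheory GRing.Theory Num.Theory.
Import numFieldNormedType.Exports.

Set Implicit Arguments.
Unset Strict Implicit.
Unset Printing Implicit Defensive.

Local Open Scope ring_scope.
Local Open Scope classical_set_scope.

(** * Frobenius inner product and norm *)

Section FrobeniusProduct.
Context {R : realType}.

Lemma mxdotE m n (X Y : 'M[R]_(m, n)) :
  mxdot X Y = \sum_i \sum_j X i j * Y i j.
Proof.
rewrite exchange_big /=; apply: eq_bigr => j _; rewrite mxE.
by apply: eq_bigr => i _; rewrite mxE.
Qed.

Lemma mxdotC m n (X Y : 'M[R]_(m, n)) : mxdot X Y = mxdot Y X.
Proof. by rewrite /mxdot -mxtrace_tr trmx_mul trmxK. Qed.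

Lemma mxdotDl m n (X Y Z : 'M[R]_(m, n)) :
  mxdot (X + Y) Z = mxdot X Z + mxdot Y Z.
Proof. by rewrite /mxdot linearD /= mulmxDl linearD. Qed.

Lemma mxdotZl m n a (X Y : 'M[R]_(m, n)) : mxdot (a *: X) Y = a * mxdot X Y.
Proof. by rewrite /mxdot linearZ /= -scalemxAl linearZ. Qed.

Lemma mxdotNl m n (X Y : 'M[R]_(m, n)) : mxdot (- X) Y = - mxdot X Y.
Proof. by rewrite -scaleN1r mxdotZl mulN1r. Qed.

Lemma mxdotDr m n (X Y Z : 'M[R]_(m, n)) :
  mxdot Z (X + Y) = mxdot Z X + mxdot Z Y.
Proof. by rewrite mxdotC mxdotDl !(mxdotC Z). Qed.

Lemma mxdotZr m n a (X Y : 'M[R]_(m, n)) : mxdot X (a *: Y) = a * mxdot X Y.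
Proof. by rewrite mxdotC mxdotZl mxdotC. Qed.

Lemma mxdotNr m n (X Y : 'M[R]_(m, n)) : mxdot X (- Y) = - mxdot X Y.
Proof. by rewrite mxdotC mxdotNl mxdotC. Qed.

Lemma mxdot0l m n (X : 'M[R]_(m, n)) : mxdot 0 X = 0.
Proof. by rewrite -(scale0r 0) mxdotZl mul0r. Qed.

Definition mxdot_lin := (@mxdotDl, @mxdotDr, @mxdotNl, @mxdotNr,
  @mxdotZl, @mxdotZr).

Lemma mxdot_mulmxl m n r (U : 'M[R]_(m, r)) (X : 'M[R]_(r, n))
    (Y : 'M[R]_(m, n)) :
  mxdot (U *m X) Y = mxdot X (U^T *m Y).
Proof. by rewrite /mxdot trmx_mul mulmxA. Qed.

Lemma mxdot_tr m n (X Y : 'M[R]_(m, n)) : mxdot X^T Y^T = mxdot X Y.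
Proof. by rewrite /mxdot trmxK mxtrace_mulC -mxtrace_tr trmx_mul trmxK. Qed.

Lemma mxdot_mulmxr m n r (X : 'M[R]_(m, r)) (V : 'M[R]_(r, n))
    (Y : 'M[R]_(m, n)) :
  mxdot (X *m V) Y = mxdot X (Y *m V^T).
Proof. by rewrite -mxdot_tr trmx_mul mxdot_mulmxl -trmx_mul mxdot_tr. Qed.

Lemma mxdot_ge0 m n (X : 'M[R]_(m, n)) : 0 <= mxdot X X.
Proof.
by rewrite mxdotE; do 2!apply: sumr_ge0 => ? _; rewrite -expr2 sqr_ge0.
Qed.

Lemma mxdot_eq0 m n (X : 'M[R]_(m, n)) : (mxdot X X == 0) = (X == 0).
Proof.
apply/eqP/eqP => [|->]; last by rewrite mxdot0l.
rewrite mxdotE => /eqP; rewrite psumr_eq0; last first.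
  by move=> i _; apply: sumr_ge0 => ? _; rewrite -expr2 sqr_ge0.
move=> /allP X0; apply/matrixP => i j; rewrite mxE.
move: (X0 i (mem_index_enum _)); rewrite psumr_eq0; last first.
  by move=> ? _; rewrite -expr2 sqr_ge0.
move=> /allP /(_ j (mem_index_enum _)).
by rewrite mulf_eq0 orbb => /eqP.
Qed.

Lemma frob_sqr m n (X : 'M[R]_(m, n)) : frob X ^+ 2 = mxdot X X.
Proof. by rewrite sqr_sqrtr ?mxdot_ge0. Qed.

Lemma frob_ge0 m n (X : 'M[R]_(m, n)) : 0 <= frob X.
Proof. exact: sqrtr_ge0. Qed.

Lemma frob_eq0 m n (X : 'M[R]_(m, n)) : (frob X == 0) = (X == 0).
Proof. by rewrite -mxdot_eq0 -frob_sqr sqrf_eq0. Qed.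

Lemma mxdot_le_mean m n (X Y : 'M[R]_(m, n)) :
  mxdot X Y <= 2^-1 * (mxdot X X + mxdot Y Y).
Proof. by have := mxdot_ge0 (X - Y); rewrite !mxdot_lin (mxdotC Y X); lra. Qed.

(** Cauchy-Schwarz, from [mxdot_le_mean] at the two normalized matrices. *)
Lemma mxdot_le_frob m n (X Y : 'M[R]_(m, n)) : mxdot X Y <= frob X * frob Y.
Proof.
have [/eqP|X0] := eqVneq (frob X) 0.
  by rewrite frob_eq0 => /eqP ->; rewrite mxdot0l mulr_ge0 ?frob_ge0.
have [/eqP|Y0] := eqVneq (frob Y) 0.
  by rewrite frob_eq0 => /eqP ->; rewrite mxdotC mxdot0l mulr_ge0 ?frob_ge0.
have := mxdot_le_mean ((frob X)^-1 *: X) ((frob Y)^-1 *: Y).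
rewrite !mxdot_lin -!frob_sqr expr2 !mulKf // mulVf // mulVf //.
have -> : 2^-1 * (1 + 1) = 1 :> R by lra.
rewrite mulrA -invfM mulrC ler_pdivrMr ?mul1r // mulrC.
by rewrite lt0r mulf_neq0 // mulr_ge0 ?frob_ge0.
Qed.

(** Bessel's inequality: expand the squared norm of the residual [X - U *m (U^T *m X)]. *)
Lemma mxdot_bessel m n r (U : 'M[R]_(m, r)) (X : 'M[R]_(m, n)) :
  U^T *m U = 1%:M -> mxdot (U^T *m X) (U^T *m X) <= mxdot X X.
Proof.
move=> UU; set Z := U^T *m X; have := mxdot_ge0 (X - U *m Z).
have UZ : mxdot (U *m Z) (U *m Z) = mxdot Z Z.
  by rewrite mxdot_mulmxl mulmxA UU mul1mx.
rewrite !mxdot_lin UZ (mxdotC X) mxdot_mulmxl -/Z; lra.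
Qed.

(** The pairing equals [mxdot (U^T *m L) (V^T *m Q)]; AM-GM and Bessel on each factor conclude. *)
Lemma mxdot_partial_isometry m n r q (U : 'M[R]_(m, r)) (V : 'M[R]_(n, r))
    (L : 'M[R]_(m, q)) (Q : 'M[R]_(n, q)) :
  U^T *m U = 1%:M -> V^T *m V = 1%:M ->
  mxdot (U *m V^T) (L *m Q^T) <= 2^-1 * (mxdot L L + mxdot Q Q).
Proof.
move=> UU VV; rewrite mxdot_mulmxl mulmxA mxdotC mxdot_mulmxr trmxK.
apply: le_trans (mxdot_le_mean _ _) _; rewrite ler_pM2l ?invr_gt0 ?ltr0n //.
by apply: lerD; apply: mxdot_bessel.
Qed.

End FrobeniusProduct.

(** * Existence of singular value decompositions *)

Section SingularValueDecomposition.
Context {R : realType}.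

Lemma continuous_sum (T : topologicalType) (I : finType) (f : I -> T -> R) :
  (forall i, continuous (f i)) -> continuous (fun x => \sum_i f i x).
Proof.
move=> cf; apply: (@continuous_big R^o) => //; exact: add_continuous.
Qed.

Lemma continuous_mxdot_mulmx m n (X : 'M[R]_(m, n)) :
  continuous (fun w : 'rV[R]_n => mxdot (X *m w^T) (X *m w^T)).
Proof.
under eq_fun do rewrite mxdotE.
have cX i j : continuous (fun w : 'rV[R]_n => (X *m w^T) i j).
  under eq_fun do rewrite mxE.
  apply: continuous_sum => k w.
  under eq_fun do rewrite mxE.
  by apply: continuousM; [exact: cst_continuous|exact: coord_continuous].
by do 2!apply: continuous_sum => ?; move=> w; apply: continuousM; exact: cX.
Qed.

Lemma mulmx_le_unit_max m n (X : 'M[R]_(m, n)) (v : 'cV[R]_n) :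
  (forall w : 'cV[R]_n, mxdot w w = 1 ->
     mxdot (X *m w) (X *m w) <= mxdot (X *m v) (X *m v)) ->
  forall w : 'cV[R]_n,
    mxdot (X *m w) (X *m w) <= mxdot (X *m v) (X *m v) * mxdot w w.
Proof.
move=> vmax w; have [->|w0] := eqVneq w 0.
  by rewrite mulmx0 !mxdot0l mulr0.
have fw0 : frob w != 0 by rewrite frob_eq0.
have /vmax : mxdot ((frob w)^-1 *: w) ((frob w)^-1 *: w) = 1.
  by rewrite !mxdot_lin -frob_sqr expr2 mulKf // mulVf.
rewrite -scalemxAr !mxdot_lin mulrA -invfM -expr2 frob_sqr ler_pdivrMl.
  by rewrite mulrC.
by rewrite lt0r mxdot_eq0 w0 mxdot_ge0.
Qed.

Lemma unit_sphere_max m n (X : 'M[R]_(m, n)) : (0 < n)%N ->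
  exists2 v : 'cV[R]_n, mxdot v v = 1 &
    forall w : 'cV[R]_n, mxdot w w = 1 ->
      mxdot (X *m w) (X *m w) <= mxdot (X *m v) (X *m v).
Proof.
case: n X => // n X _.
pose S := [set w : 'rV[R]_n.+1 | mxdot w w = 1].
have cdot : continuous (fun w : 'rV[R]_n.+1 => mxdot w w).
  have := @continuous_mxdot_mulmx n.+1 n.+1 1%:M.
  by under eq_fun do rewrite mul1mx mxdot_tr.
have S0 : S !=set0.
  exists (delta_mx 0 0); rewrite /S /= mxdotE big_ord1 (bigD1 0) //= big1.
    by rewrite mxE !eqxx mulr1 addr0.
  by move=> i i0; rewrite mxE (negbTE i0) andbF mulr0.
have cS : compact S.
  apply: bounded_closed_compact; last first.
    by apply: preimage_closed (@closed_eq R 1) => x _; exact: cdot.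
  exists 1; split => // M M1 w; rewrite /S /= => w1.
  have [->|w0] := eqVneq w 0; first by rewrite normr0; lra.
  (* The norm here is the max norm: it is attained at one entry, whose square is a term of
     [mxdot w w]. *)
  rewrite -[`|w|]/(mx_norm w).
  have [|[i j] /= ->] := @mx_norm_neq0 _ _ _ w.
    by apply: contraNneq w0 => /mx_norm_eq0 ->.
  suff : `|w i j| ^+ 2 <= 1.
    by rewrite expr_le1 // => /le_trans; apply; exact: ltW.
  rewrite -w1 mxdotE (bigD1 i) //= (bigD1 j) //= real_normK ?num_real // expr2.
  rewrite -addrA lerDl addr_ge0 // ?sumr_ge0 // => ? _;
    rewrite -?expr2 ?sqr_ge0 //.
  by rewrite sumr_ge0 // => ? _; rewrite -expr2 sqr_ge0.
have [c] := compact_EVT_max S0 cS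
  (continuous_subspaceT (@continuous_mxdot_mulmx _ _ X)).
rewrite inE => Sc cmax; exists c^T; first by rewrite mxdot_tr.
by move=> w w1; rewrite -[w]trmxK; apply: cmax; rewrite inE /S /= mxdot_tr.
Qed.

(** Let [v] maximize |X v| on the unit sphere, with maximum [a], and let u = X v / a. Then |X^T u|
    <= a while <X^T u, v> = a, which forces X^T u = a v. *)
Lemma top_singular_pair m n (X : 'M[R]_(m, n)) : X != 0 ->
  exists a (u : 'cV[R]_m) (v : 'cV[R]_n),
    [/\ 0 < a, mxdot u u = 1, mxdot v v = 1, X *m v = a *: u &
        X^T *m u = a *: v].
Proof.
move=> X0; have n0 : (0 < n)%N.
  by move: X X0; case: n => // X; rewrite [X]thinmx0 eqxx.
have [v v1 /mulmx_le_unit_max vmax] := unit_sphere_max X n0.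
set a := frob (X *m v); have a2 : a ^+ 2 = mxdot (X *m v) (X *m v).
  exact: frob_sqr.
have a0 : 0 < a.
  rewrite lt0r frob_ge0 andbT; apply: contra_neq X0 => a0.
  have {vmax} : forall w : 'cV[R]_n, X *m w = 0.
    move=> w; apply/eqP; rewrite -mxdot_eq0 eq_le mxdot_ge0 andbT.
    by apply: le_trans (vmax w) _; rewrite -a2 a0 expr0n /= mul0r.
  move=> Xw; apply/matrixP => i j; move: (Xw (delta_mx j 0)).
  by rewrite -colE => /matrixP /(_ i 0); rewrite !mxE.
have an0 : a != 0 by rewrite gt_eqF.
exists a, (a^-1 *: (X *m v)), v; split=> //.
- by rewrite !mxdot_lin -a2 expr2 mulKf // mulVf.
- by rewrite scalerA divff // scale1r.
set u := a^-1 *: (X *m v).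
have Xuv : mxdot (X^T *m u) v = a.
  by rewrite mxdot_mulmxl trmxK mxdotZl -a2 expr2 mulKf.
have u1 : mxdot u u = 1 by rewrite !mxdot_lin -a2 expr2 mulKf // mulVf.
(* With w = X^T u, |w|^2 = <u, X w> <= |X w| <= a |w|. *)
have Xu : mxdot (X^T *m u) (X^T *m u) <= a ^+ 2.
  set w := X^T *m u; have := mxdot_le_frob u (X *m w).
  have -> : mxdot u (X *m w) = mxdot w w by rewrite mxdotC mxdot_mulmxl.
  have -> : frob u = 1 by rewrite /frob u1 sqrtr1.
  rewrite mul1r => wX; have := vmax w; rewrite -a2 -!frob_sqr => Xw.
  have {}Xw : frob (X *m w) <= a * frob w.
    by rewrite -ler_sqr ?nnegrE ?mulr_ge0 ?frob_ge0 // exprMn.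
  move: (le_trans wX Xw); rewrite -frob_sqr ler_sqr ?nnegrE ?frob_ge0 //.
  have [->|w0] := eqVneq (frob w) 0; first by rewrite frob_ge0.
  by rewrite expr2 ler_pM2r // lt0r w0 frob_ge0.
(* |X^T u - a v|^2 = |X^T u|^2 - 2 a^2 + a^2 <= 0. *)
apply/eqP; rewrite -subr_eq0 -mxdot_eq0 eq_le mxdot_ge0 andbT.
rewrite !mxdot_lin (mxdotC v) Xuv v1; nra.
Qed.

Lemma mulmx_diag_eq0 m r (M : 'M[R]_(m, r)) (s : 'rV[R]_r) :
  (forall i, 0 < s 0 i) -> M *m diag_mx s = 0 -> M = 0.
Proof.
move=> s0 /matrixP Ms; apply/matrixP => i j; move: (Ms i j).
rewrite mul_mx_diag !mxE => /eqP; rewrite mulf_eq0 => /orP[/eqP //|].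
by rewrite gt_eqF.
Qed.

Lemma mulmx_tr_unit m (u : 'cV[R]_m) : mxdot u u = 1 -> u^T *m u = 1%:M.
Proof.
move=> u1; rewrite [LHS]mx11_scalar; congr (_%:M).
by rewrite -u1 /mxdot trace_mx11.
Qed.

(* Deflation: subtracting the rank one term of a pair of top singular vectors
   lowers the rank and leaves a matrix which annihilates both vectors. *)
Lemma svd_pos_exists m n (X : 'M[R]_(m, n)) :
  exists r U (s : 'rV[R]_r) V, is_svd X U s V /\ forall i, 0 < s 0 i.
Proof.
have [k] := ubnP (\rank X); elim: k X => // k IH X rkX.
have [->|X0] := eqVneq X 0.
  exists 0%N, 0, 0, 0; split; last by case.
  by split; rewrite ?flatmx0 ?mul0mx //; [apply/matrixP => -[]..|case].
have [a [u [v [a0 u1 v1 Xv Xu]]]] := top_singular_pair X0.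
have uu := mulmx_tr_unit u1; have vv := mulmx_tr_unit v1.
have uX : u^T *m X = a *: v^T by rewrite -[LHS]trmxK trmx_mul trmxK Xu linearZ.
pose X' := X - a *: (u *m v^T).
have X'v : X' *m v = 0.
  by rewrite mulmxBl Xv -scalemxAl -mulmxA vv mulmx1 subrr.
have uX' : u^T *m X' = 0.
  by rewrite mulmxBr uX -scalemxAr mulmxA uu mul1mx subrr.
(* The row space of [X'] lies in that of [X] but misses [v^T]: if v^T = M X', then v^T v = M X' v =
   0. *)
have rkX' : (\rank X' < \rank X)%N.
  rewrite rank_ltmx // ltmxE; apply/andP; split.
    have -> : X' = (1%:M - u *m u^T) *m X.
      by rewrite mulmxBl mul1mx -mulmxA uX -scalemxAr.
    exact: submxMl.
  apply/negP => XX'; have : (v^T <= X')%MS.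
    apply: submx_trans XX'; rewrite -[v^T](scalerK (lt0r_neq0 a0)) -uX.
    by rewrite scalemx_sub // submxMl.
  move=> /submxP [M vM]; have /eqP := vv; rewrite vM -mulmxA X'v mulmx0.
  by rewrite eq_sym oner_eq0.
have [r [U [s [V [[UU VV s0' X'E] s0]]]]] := IH X' (leq_trans rkX' rkX).
(* From u^T X' = 0 follows u^T U diag(s) = 0, and positivity of the singular values cancels diag(s).
   This is why the induction carries strict positivity. *)
have uU : u^T *m U = 0.
  apply: (mulmx_diag_eq0 s0); rewrite -[LHS]mulmx1 -VV mulmxA.
  by rewrite -2!(mulmxA u^T) -X'E uX' mul0mx.
have vV : v^T *m V = 0.
  apply: (mulmx_diag_eq0 s0); rewrite -[LHS]mulmx1 -UU mulmxA.
  have -> : v^T *m V *m diag_mx s *m U^T = (X' *m v)^T.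
    by rewrite X'E !trmx_mul trmxK tr_diag_mx !mulmxA.
  by rewrite X'v trmx0 mul0mx.
exists (1 + r)%N, (row_mx u U), (row_mx a%:M s), (row_mx v V).
have Uu : U^T *m u = 0 by rewrite -[LHS]trmxK trmx_mul trmxK uU trmx0.
have Vv : V^T *m v = 0 by rewrite -[LHS]trmxK trmx_mul trmxK vV trmx0.
have sE i : 0 < (row_mx a%:M s : 'rV[R]_(1 + r)) 0 i.
  rewrite mxE; case: splitP => j _; last exact: s0.
  by rewrite ord1 mxE eqxx mulr1n.
split=> //; split.
- by rewrite tr_row_mx mul_col_row uu uU Uu UU -scalar_mx_block.
- by rewrite tr_row_mx mul_col_row vv vV Vv VV -scalar_mx_block.
- by move=> i; exact: ltW.
rewrite diag_mx_row tr_row_mx mul_row_block !mulmx0 addr0 add0r mul_row_col.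
have -> : diag_mx (a%:M : 'M[R]_1) = a%:M.
  by apply/matrixP => i j; rewrite !ord1 !mxE eqxx.
by rewrite -X'E mul_mx_scalar -scalemxAl addrC subrK.
Qed.

End SingularValueDecomposition.

(** * The nuclear norm by duality *)

Section NuclearNorm.
Context {R : realType}.

(** [U *m V^T] is the dual certificate of [X]: it attains the bound of [svd_dual_le]. *)
Lemma svd_diag_sum m n r (X : 'M[R]_(m, n)) U (s : 'rV[R]_r) V :
  is_svd X U s V -> mxdot (U *m V^T) X = \sum_i s 0 i.
Proof.
move=> [UU VV _ ->]; rewrite mxdotC mxdot_mulmxr trmxK -mulmxA VV mulmx1.
by rewrite mxdot_mulmxl UU mxdotC /mxdot trmx1 mul1mx mxtrace_diag.
Qed.

Lemma svd_sqrt_factors m n r (X : 'M[R]_(m, n)) U (s : 'rV[R]_r) V :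
  is_svd X U s V ->
  let L := U *m diag_mx (map_mx Num.sqrt s) in
  let Q := V *m diag_mx (map_mx Num.sqrt s) in
  [/\ L *m Q^T = X, mxdot L L = \sum_i s 0 i & mxdot Q Q = \sum_i s 0 i].
Proof.
move=> [UU VV s0 XE] L Q; set d := diag_mx (map_mx Num.sqrt s).
have dd : d *m d = diag_mx s.
  rewrite mulmx_diag; congr diag_mx; apply/rowP => i; rewrite !mxE.
  by rewrite -expr2 sqr_sqrtr.
have dtr : mxdot d d = \sum_i s 0 i.
  by rewrite /mxdot tr_diag_mx dd mxtrace_diag.
split.
- by rewrite XE /L /Q trmx_mul tr_diag_mx -/d !mulmxA -(mulmxA U) dd.
- by rewrite mxdot_mulmxl mulmxA UU mul1mx.
- by rewrite mxdot_mulmxl mulmxA VV mul1mx.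
Qed.

(** Splitting Sigma evenly between two factors turns the bound of [mxdot_partial_isometry] into the
    mean of two equal sums. *)
Lemma svd_dual_le m n r (X : 'M[R]_(m, n)) U (s : 'rV[R]_r) V
    r' (U' : 'M[R]_(m, r')) (V' : 'M[R]_(n, r')) :
  U'^T *m U' = 1%:M -> V'^T *m V' = 1%:M -> is_svd X U s V ->
  mxdot (U' *m V'^T) X <= \sum_i s 0 i.
Proof.
move=> UU VV /svd_sqrt_factors[<- LL QQ].
by apply: le_trans (mxdot_partial_isometry _ _ UU VV) _; rewrite LL QQ; lra.
Qed.

(** Of two decompositions of [X], each sum is the pairing of [X] with its own certificate, hence at
    most the other sum. So [xget] has only one value to choose. *)
Lemma nuclear_normE m n r (X : 'M[R]_(m, n)) U (s : 'rV[R]_r) V :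
  is_svd X U s V -> nuclear_norm X = \sum_i s 0 i.
Proof.
move=> svdX; rewrite /nuclear_norm; case: xgetP => [t -> |/(_ (\sum_i s 0 i))].
  move=> [r' [U' [s' [V' [svdX' ->]]]]]; apply/eqP.
  rewrite eq_le.
  case: (svdX) => UU VV _ _; case: (svdX') => UU' VV' _ _.
  apply/andP; split.
    by rewrite -(svd_diag_sum svdX'); exact: svd_dual_le UU' VV' svdX.
  by rewrite -(svd_diag_sum svdX); exact: svd_dual_le UU VV svdX'.
by case; exists r, U, s, V.
Qed.

Lemma nuclear_norm_dual_le m n r (X : 'M[R]_(m, n))
    (U : 'M[R]_(m, r)) (V : 'M[R]_(n, r)) :
  U^T *m U = 1%:M -> V^T *m V = 1%:M -> mxdot (U *m V^T) X <= nuclear_norm X.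
Proof.
move=> UU VV; have [r' [U' [s [V' [svdX _]]]]] := svd_pos_exists X.
by rewrite (nuclear_normE svdX) (svd_dual_le UU VV svdX).
Qed.

(** The certificate U V^T of [X] is a subgradient: its pairing is exact at [X] and a lower bound
    elsewhere. *)
Lemma nuclear_norm_subgradient m n (X : 'M[R]_(m, n)) :
  exists2 G, nuclear_norm X = mxdot G X &
    forall Y, mxdot G Y <= nuclear_norm Y.
Proof.
have [r [U [s [V [svdX _]]]]] := svd_pos_exists X.
exists (U *m V^T); first by rewrite (nuclear_normE svdX) (svd_diag_sum svdX).
by case: svdX => UU VV _ _ Y; exact: nuclear_norm_dual_le.
Qed.

Lemma nuclear_norm_mulmx_le m n r (L : 'M[R]_(m, r)) (Q : 'M[R]_(n, r)) :
  nuclear_norm (L *m Q^T) <= 2^-1 * (mxdot L L + mxdot Q Q).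
Proof.
have [r' [U [s [V [svdX _]]]]] := svd_pos_exists (L *m Q^T).
rewrite (nuclear_normE svdX) -(svd_diag_sum svdX).
by case: svdX => UU VV _ _; exact: mxdot_partial_isometry.
Qed.

Lemma nuclear_norm_ge0 m n (X : 'M[R]_(m, n)) : 0 <= nuclear_norm X.
Proof.
have [r [U [s [V [svdX s0]]]]] := svd_pos_exists X.
by rewrite (nuclear_normE svdX) sumr_ge0 // => i _; exact: ltW.
Qed.

(** For nonnegative s_i, the sum of the s_i^2 is at most the square of the sum. This later bounds
    the iterates. *)
Lemma frob_le_nuclear_norm m n (X : 'M[R]_(m, n)) : frob X <= nuclear_norm X.
Proof.
rewrite -ler_sqr ?nnegrE ?frob_ge0 ?nuclear_norm_ge0 // frob_sqr.
have [r [U [s [V [svdX s0]]]]] := svd_pos_exists X.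
rewrite (nuclear_normE svdX); case: svdX => UU VV _ ->.
rewrite -mulmxA mxdot_mulmxl mulmxA UU mul1mx mxdot_mulmxr trmxK -mulmxA VV.
rewrite mulmx1 /mxdot tr_diag_mx mulmx_diag mxtrace_diag expr2 mulr_suml.
apply: ler_sum => i _; rewrite mxE ler_pM2l // (bigD1 i) //= lerDl.
by rewrite sumr_ge0 // => j _; exact: ltW.
Qed.

End NuclearNorm.

(** * Least squares, convexity of the objective and the proximal gradient step *)

Section LeastSquares.
Context {R : realType} {m n p : nat}.
Variables (A : {linear 'M[R]_(m, n) -> 'cV[R]_p}) (b : 'cV[R]_p) (lam : R).

Local Notation phi := (least_squares A b).
Local Notation Lip := (L_AA A b).
Local Notation gphi X := (adjoint A (A X - b)).

Lemma adjointB y z : adjoint A (y - z) = adjoint A y - adjoint A z.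
Proof. by apply/matrixP => i j; rewrite !mxE !mxdot_lin. Qed.

Lemma least_squares_expand X Y :
  phi Y = phi X + mxdot (gphi X) (Y - X) + 2^-1 * mxdot (A (Y - X)) (A (Y - X)).
Proof.
rewrite /least_squares !frob_sqr [mxdot (gphi X) _]mxdotC -adjointP linearB /=.
rewrite !mxdot_lin (mxdotC b) (mxdotC (A X) (A Y)) (mxdotC b (A X)); lra.
Qed.

Lemma least_squares_subgradient X Y :
  phi X + mxdot (gphi X) (Y - X) <= phi Y.
Proof.
rewrite (least_squares_expand X Y) lerDl.
by rewrite mulr_ge0 ?invr_ge0 ?ler0n ?mxdot_ge0.
Qed.

Lemma grad_least_squares X : grad phi X = gphi X.
Proof.
apply/matrixP => i j; rewrite [LHS]mxE /derive.
set g := gphi X i j; set e := delta_mx i j.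
have ge : mxdot (gphi X) e = g.
  by rewrite mxdotC -adjointP /g mxE.
apply: cvg_lim => //.
(* Away from 0 the difference quotient is this affine function of [h], whose limit at 0 is [g]. *)
pose q (h : R) := g + h * (2^-1 * mxdot (A e) (A e)).
suff : q h @[h --> 0^'] --> g.
  apply: cvg_trans; apply: near_eq_cvg.
  near=> h; have h0 : h != 0 by near: h; exact: nbhs_dnbhs_neq.
  rewrite /q /= /shift (least_squares_expand X) addrK linearZ /= !mxdot_lin ge.
  by rewrite -[h^-1 *: _]/(h^-1 * _); field.
have -> : g = q 0 by rewrite /q mul0r addr0.
apply: cvg_within_filter; apply: cvgD; first exact: cvg_cst.
by apply: cvgM; [exact: cvg_id|exact: cvg_cst].
Unshelve. all: by end_near. Qed.

(** [L_AA] is an infimum, and bounding it from below requires a nonempty set. *)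
Lemma Lip_set_nonempty :
  [set c : R | 0 <= c /\ forall X Y,
     frob (grad phi X - grad phi Y) <= c * frob (X - Y)] !=set0.
Proof.
pose W i j := adjoint A (A (delta_mx i j)).
(* Entry (i, j) of A^*A D is <W i j, D>, so Cauchy-Schwarz on each entry gives |A^*A D|^2 <= C
   |D|^2. *)
pose C := \sum_i \sum_j mxdot (W i j) (W i j).
have C0 : 0 <= C by do 2!apply: sumr_ge0 => ? _; exact: mxdot_ge0.
exists (Num.sqrt C); split=> [|X Y]; first exact: sqrtr_ge0.
rewrite !grad_least_squares -adjointB opprB addrA subrK -linearB /=.
set D := X - Y; rewrite -ler_sqr ?nnegrE ?mulr_ge0 ?sqrtr_ge0 ?frob_ge0 //.
rewrite exprMn !frob_sqr sqr_sqrtr // mxdotE mulr_suml; apply: ler_sum => i _.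
rewrite mulr_suml; apply: ler_sum => j _.
rewrite mxE mxdotC adjointP -/(W i j) -expr2 -!frob_sqr -exprMn.
rewrite -[leLHS]real_normK ?num_real // ler_sqr ?nnegrE ?mulr_ge0 ?frob_ge0 //.
rewrite ler_norml mulrC lerNl -mxdotNl mxdot_le_frob andbT.
by apply: le_trans (mxdot_le_frob _ _) _; rewrite /frob !mxdot_lin opprK.
Qed.

(** |A D|^2 = <D, A^*A D> <= c |D|^2 for every Lipschitz constant [c], hence for their infimum. *)
Lemma linear_frob_le_Lip D : mxdot (A D) (A D) <= Lip * mxdot D D.
Proof.
have [->|D0] := eqVneq D 0; first by rewrite linear0 !mxdot0l mulr0.
have DD : 0 < mxdot D D by rewrite lt0r mxdot_eq0 D0 mxdot_ge0.
rewrite -ler_pdivrMr //; apply: lb_le_inf; first exact: Lip_set_nonempty.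
move=> c [c0 /(_ D 0)]; rewrite !grad_least_squares -adjointB linear0.
rewrite opprB !subr0 subrK => gD; rewrite ler_pdivrMr //.
rewrite adjointP; apply: le_trans (mxdot_le_frob _ _) _.
by rewrite -frob_sqr expr2 mulrCA ler_wpM2l ?frob_ge0.
Qed.

Hypothesis Ab0 : adjoint A b != 0.

(** Since <A A^*b, b> = |A^*b|^2 > 0, [A] does not vanish at A^*b, and the previous bound applies
    there. *)
Lemma Lip_gt0 : 0 < Lip.
Proof.
have Ab : 0 < mxdot (adjoint A b) (adjoint A b).
  by rewrite lt0r mxdot_eq0 Ab0 mxdot_ge0.
have := linear_frob_le_Lip (adjoint A b).
have AA : 0 < mxdot (A (adjoint A b)) (A (adjoint A b)).
  rewrite lt0r mxdot_eq0 mxdot_ge0 andbT; apply: contraTneq Ab => AAb0.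
  by rewrite -adjointP AAb0 mxdot0l ltxx.
by move=> /(lt_le_trans AA); rewrite pmulr_lgt0.
Qed.

Hypothesis lam0 : 0 < lam.
Local Notation f := (f_lam A b lam).

Lemma f_subgradient X : exists G, forall Y, f X + mxdot G (Y - X) <= f Y.
Proof.
have [G GX GY] := nuclear_norm_subgradient X.
exists (lam *: G + gphi X) => Y; have := least_squares_subgradient X Y.
have := GY Y; rewrite /f_lam GX !mxdot_lin -(ler_pM2l lam0); lra.
Qed.

(** Average the subgradient inequalities at the intermediate point [Z]: the linear terms cancel. *)
Lemma f_convex X Y t : 0 <= t <= 1 ->
  f ((1 - t) *: X + t *: Y) <= (1 - t) * f X + t * f Y.
Proof.
move=> t01; set Z := _ + _; have [G GZ] := f_subgradient Z.
have -> : f Z = (1 - t) * (f Z + mxdot G (X - Z)) + t * (f Z + mxdot G (Y - Z)).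
  by rewrite /Z !mxdot_lin; ring.
by apply: lerD; apply: ler_wpM2l; try exact: GZ; lra.
Qed.

(** Up to a constant, [Lip] times the prox objective is the nuclear term plus the linearized least
    squares plus L/2 |W - X|^2. At [Xp] this model dominates [f]; at [Y] its linear part is below
    least squares by convexity. *)
Lemma PG_descent X Xp Y : PG A b lam X Xp ->
  f Xp <= f Y + Lip / 2 * mxdot (Y - X) (Y - X).
Proof.
have L0 := Lip_gt0; set g := gphi X.
have expand W : Lip * (lam / Lip * nuclear_norm W
      + 2^-1 * frob (W - (X - Lip^-1 *: g)) ^+ 2) =
    lam * nuclear_norm W + Lip / 2 * mxdot (W - X) (W - X) + mxdot g (W - X)
      + 2^-1 * Lip^-1 * mxdot g g.
  rewrite frob_sqr opprB addrCA.
  move: (W - X) => D; rewrite !mxdot_lin (mxdotC D).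
  by field; rewrite gt_eqF.
move=> /(_ Y) /=; rewrite -(ler_pM2l L0) -/g !expand.
have := least_squares_subgradient X Y.
have := linear_frob_le_Lip (Xp - X).
rewrite /f_lam (least_squares_expand X Xp) -/g; lra.
Qed.

End LeastSquares.

Lemma adjoint_neq0 (R : realType) m n p
    (A : {linear 'M[R]_(m, n) -> 'cV[R]_p}) (b : 'cV[R]_p) :
  0 < spectral_norm (adjoint A b) -> adjoint A b != 0.
Proof.
apply: contraTneq => ->; rewrite /spectral_norm.
rewrite (_ : [set _ | _ in _] = [set 0]).
  by rewrite sup1 ltxx.
have frob0 k : frob (0 : 'cV[R]_k) = 0 by apply/eqP; rewrite frob_eq0.
apply/seteqP; split=> [_ [v _ <-]|_ ->] /=; first by rewrite mul0mx frob0.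
by exists 0; rewrite /= ?mul0mx frob0 ?ler01.
Qed.

(* Take t = 2 / (i + 2) as in the Frank-Wolfe method. *)
Lemma frank_wolfe_rate (R : realType) (d : nat -> R) (C : R) : 0 <= C ->
  (forall i t, 0 <= t <= 1 -> d i.+1 <= (1 - t) * d i + C * t ^+ 2) ->
  forall i, d i.+1 <= 4 * C / (i%:R + 3).
Proof.
move=> C0 dS; elim=> [|i IH].
  (* With t = 1 the term [d 0] disappears and d 1 <= C <= 4 C / 3. *)
  have := dS 0%N 1; rewrite lexx ler01 => /(_ isT) /le_trans; apply.
  by rewrite subrr mul0r !add0r expr1n; lra.
have i0 : 0 <= i%:R :> R by rewrite ler0n.
(* The recursion is applied at index i + 1, whence i + 3. *)
set t : R := 2 / (i%:R + 3).
have t01 : 0 <= t <= 1.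
  by rewrite divr_ge0 //= ?ler_pdivrMr; lra.
apply: le_trans (dS i.+1 t t01) _.
have t1 : 0 <= 1 - t by case/andP: t01; lra.
apply: le_trans (lerD (ler_wpM2l t1 IH) (lexx _)) _.
have -> : (1 - t) * (4 * C / (i%:R + 3)) + C * t ^+ 2 =
    4 * C * (i%:R + 2) / (i%:R + 3) ^+ 2.
  by rewrite /t; field; lra.
have i3 : 0 < i%:R + 3 :> R by lra.
have i4 : 0 < i.+1%:R + 3 :> R by rewrite -(natr1 i); lra.
rewrite ler_pdivrMr ?exprn_gt0 // [leRHS]mulrAC ler_pdivlMr //.
(* What remains is (i + 2)(i + 4) <= (i + 3)^2. *)
by rewrite -[leLHS]mulrA ler_wpM2l ?mulr_ge0 // -(natr1 i); lra.
Qed.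

(** * Descent of the objective and its O(1/i) rate *)

Section Descent.
Context {R : realType} {m n p : nat}.
Variables (A : {linear 'M[R]_(m, n) -> 'cV[R]_p}) (b : 'cV[R]_p) (lam : R).
Hypothesis lam0 : 0 < lam.
Local Notation f := (f_lam A b lam).

Definition g_factors (Fk : factors R m n) : R :=
  g_lam A b lam (lfac Fk) (rfac Fk).

Lemma alt_min_descent F1 F2 :
  alt_min A b lam F1 F2 -> g_factors F2 <= g_factors F1.
Proof. by case=> r L L' Q Q' Lmin Qmin; exact: le_trans (Qmin Q) (Lmin L). Qed.

Lemma f_le_g_factors Fk : f (lfac Fk *m (rfac Fk)^T) <= g_factors Fk.
Proof.
rewrite /g_factors /f_lam /g_lam lerD2r -mulrA ler_pM2l // !frob_sqr.
exact: nuclear_norm_mulmx_le.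
Qed.

Lemma lr_svd_g_factors X Fk : lr_svd X Fk -> g_factors Fk = f X.
Proof.
move=> [r [U [s [V [svdX ->]]]]]; rewrite /g_factors /g_lam /f_lam /= !frob_sqr.
rewrite (nuclear_normE svdX); have [-> -> ->] := svd_sqrt_factors svdX; lra.
Qed.

Hypothesis Ab0 : adjoint A b != 0.
Local Notation Lip := (L_AA A b).

Variables x xp : nat -> 'M[R]_(m, n).
Hypothesis xpP : forall i, PG A b lam (x i) (xp i).
Hypothesis xS : forall i, f (x i.+1) <= f (xp i).

Lemma prox_le i : f (xp i) <= f (x i).
Proof.
apply: le_trans (PG_descent Ab0 (x i) (xpP i)) _.
by rewrite subrr mxdot0l mulr0 addr0.
Qed.

(** The objective decreases along [x], and lam |X| <= lam |X|_* <= f X bounds its sublevel sets. *)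
Lemma iterates_bounded W :
  exists2 C, 0 <= C & forall i, mxdot (W - x i) (W - x i) <= C.
Proof.
pose B := f (x 0) / lam.
have fx i : f (x i) <= f (x 0).
  by elim: i => // i; apply: le_trans; exact: le_trans (xS i) (prox_le i).
have xB i : frob (x i) <= B.
  rewrite ler_pdivlMr // mulrC; apply: le_trans (fx i).
  apply: le_trans (_ : _ <= lam * nuclear_norm (x i)) _.
    by rewrite ler_pM2l // frob_le_nuclear_norm.
  by rewrite lerDl mulr_ge0 ?sqr_ge0 // invr_ge0 ler0n.
exists (2 * mxdot W W + 2 * B ^+ 2) => [|i].
  by apply: addr_ge0; apply: mulr_ge0; rewrite ?mxdot_ge0 ?sqr_ge0 ?ler0n.
have : mxdot (x i) (x i) <= B ^+ 2.
  rewrite -frob_sqr ler_sqr ?nnegrE ?frob_ge0 ?xB //.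
  exact: le_trans (frob_ge0 _) (xB 0%N).
(* |W - x|^2 = 2 |W|^2 + 2 |x|^2 - |W + x|^2. *)
have := mxdot_ge0 (W + x i); rewrite !mxdot_lin (mxdotC (x i) W); lra.
Qed.

Lemma prox_gradient_rate W :
  exists2 C, 0 <= C & forall i, f (x i.+1) - f W <= C / (i%:R + 3).
Proof.
have [D D0 xD] := iterates_bounded W; have L0 := Lip_gt0 Ab0.
pose C := Lip / 2 * D; have C0 : 0 <= C by rewrite !mulr_ge0 // ltW.
exists (4 * C); first by rewrite mulr_ge0.
(* The gap to an arbitrary [W] may become negative; the recursion covers this case too. *)
apply: (@frank_wolfe_rate _ (fun i => f (x i) - f W)) => // i t t01.
pose Z := (1 - t) *: x i + t *: W.
have := le_trans (xS i) (PG_descent Ab0 Z (xpP i)).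
have -> : Z - x i = t *: (W - x i).
  by rewrite /Z scalerBl scale1r scalerBr -addrA addrC subrKA addrC.
rewrite !mxdot_lin => xZ; have := f_convex A b lam0 (x i) W t01.
rewrite -/Z; have := ler_wpM2l (mulr_ge0 (ltW L0) (sqr_ge0 t)) (xD i).
rewrite /C !mxdot_lin; lra.
Qed.

End Descent.

(** * Runs of the method between consecutive proximal steps *)

Section Run.
Context {R : realType} {m n p : nat}.
Variables (A : {linear 'M[R]_(m, n) -> 'cV[R]_p}) (b : 'cV[R]_p) (lam : R).
Hypothesis lam0 : 0 < lam.
Variables (X0 : 'M[R]_(m, n)) (eps : R) (kcheck : nat).
Variables (F : nat -> factors R m n) (Xp : nat -> 'M[R]_(m, n)).
Hypothesis run : proximal_generation A b lam X0 eps kcheck F Xp.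
Local Notation prox_step := (prox_step A b lam eps kcheck F).
Variable k : nat -> nat.
Hypothesis kP : increasing_enum prox_step k.

Lemma enum_prox_step i : prox_step (k i).
Proof.
case: kP => _ kr; have : range k (k i) by exists i.
by rewrite kr.
Qed.

(** Otherwise [j] would be some [k l], and strict monotonicity would force i < l < i + 1. *)
Lemma enum_between i j : (k i < j < k i.+1)%N -> ~~ prox_step j.
Proof.
case: kP => kmono kr /andP[ij ji]; apply/negP => Pj.
have [l _ lj] : range k j by rewrite kr.
have klt a c : (k a < k c)%N -> (a < c)%N.
  by apply: contraTT; rewrite -!leqNgt leq_eqVlt => /predU1P[->//|/kmono/ltnW].
by have := klt i l; have := klt l i.+1; rewrite lj ij ji; lia.
Qed.

Lemma run_descent i :
  f_lam A b lam (iterate X0 F (k i.+1)) <= f_lam A b lam (Xp (k i)).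
Proof.
case: run => proxP altP.
have [_ /lr_svd_g_factors gF] := proxP _ (enum_prox_step i).
have kS : (k i < k i.+1)%N by case: kP => + _; apply.
(* At d = 0 stands the LR-SVD pair that follows the proximal step; each later pair, up to index
   [k i.+1] included, comes from alternating minimization. *)
have dec d : (k i + d.+1 <= k i.+1)%N ->
    g_factors A b lam (F (k i + d.+1)) <= f_lam A b lam (Xp (k i)).
  elim: d => [_|d IH kd]; first by rewrite addn1 gF.
  have /altP : ~~ prox_step (k i + d.+1).
    by apply: (@enum_between i); lia.
  rewrite -addnS => /alt_min_descent /le_trans; apply; apply: IH; lia.
have := dec (k i.+1 - (k i).+1)%N; rewrite addnS -addSn subnKC // leqnn.
move=> /(_ isT); apply: le_trans.
(* Since [k i.+1] is positive, [iterate] is there the product of the factors and not [X0]. *)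
by case: (k i.+1) kS => // j _; exact: f_le_g_factors.
Qed.

End Run.

(* A cluster point only sees a minorant of [f] which is affine, hence
   continuous. *)
Lemma cluster_le (R : realType) m n (f : 'M[R]_(m, n) -> R) (X G : 'M[R]_(m, n))
    (u : nat -> 'M[R]_(m, n)) (c : R) :
  (forall Y, f X + mxdot G (Y - X) <= f Y) ->
  (forall e, 0 < e -> \forall i \near \oo, f (u i) <= c + e) ->
  cluster (u @ \oo) X -> f X <= c.
Proof.
move=> fG fu clX; apply/ler_addgt0Pr => e e0.
have e20 : 0 < e / 2 by rewrite divr_gt0.
pose h (Y : 'M[R]_(m, n)) := mxdot G (Y - X).
have ch : continuous h.
  have cX i j : continuous (fun Y : 'M[R]_(m, n) => (Y - X) i j).
    under eq_fun do rewrite !mxE.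
    by move=> Y; apply: continuousB;
      [exact: coord_continuous|exact: cst_continuous].
  rewrite /h; under eq_fun do rewrite mxdotE.
  do 2!apply: continuous_sum => ?; move=> Y.
  by apply: continuousM; [exact: cst_continuous|exact: cX].
have hX : \forall Y \near X, `|h X - h Y| < e / 2.
  by have /cvgrPdist_lt := ch X; apply.
(* The cluster property yields a [Y] meeting both conditions; then f X <= f Y - h Y <= c + e. *)
have [Y [[/= uY hY]]] : [set Y | f Y <= c + e / 2] `&`
    [set Y | `|h X - h Y| < e / 2] !=set0.
  by apply: clX => //; exact: fu.
have := fG Y; rewrite -/(h Y); move: hY.
have -> : h X = 0 by rewrite /h subrr mxdotC mxdot0l.
by rewrite sub0r normrN ltr_norml => /andP[+ _]; lra.
Qed.

(** * Rate and limit points of the method *)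

Unset Implicit Arguments.

Theorem proposition14 (R : realType) (m n p : nat)
  (A : {linear 'M[R]_(m, n) -> 'cV[R]_p}) (b : 'cV[R]_p) (lam : R)
  (hAb : 0 < spectral_norm (adjoint A b)) (hlam : 0 < lam)
  (X0 : 'M[R]_(m, n)) (eps : R) (heps : 0 < eps)
  (kcheck : nat) (hkcheck : (0 < kcheck)%N)
  (F : nat -> factors R m n) (Xp : nat -> 'M[R]_(m, n))
  (hrun : proximal_generation A b lam X0 eps kcheck F Xp)
  (k : nat -> nat)
  (hk : increasing_enum (prox_step A b lam eps kcheck F) k) :
  (forall Xs : 'M[R]_(m, n), argmin (f_lam A b lam) Xs ->
     (fun i : nat => f_lam A b lam (iterate X0 F (k i)) - f_lam A b lam Xs)
       =O_\oo (fun i : nat => i%:R^-1 : R)) /\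
  (forall Xbar : 'M[R]_(m, n), cluster ((fun i : nat => Xp (k i)) @ \oo) Xbar ->
     argmin (f_lam A b lam) Xbar).
Proof.
have Ab0 := adjoint_neq0 hAb.
have xpP i : PG A b lam (iterate X0 F (k i)) (Xp (k i)).
  by case: hrun => proxP _; case: (proxP _ (enum_prox_step hk i)).
have rate := prox_gradient_rate hlam Ab0 xpP (run_descent hlam hrun hk).
split=> [Xs Xsmin|X clX W].
  (* The constant must be positive, while [C] may be 0; hence [C + 1]. *)
  have [C C0 xC] := rate Xs; apply/eqO_exP; exists (C + 1); first lra.
  (* The rate starts at index 1, and at index 0 the comparison value [0^-1] is 0. Minimality of [Xs]
     removes the absolute value. *)
  exists 1%N => // -[//|i] _ /=; rewrite !ger0_norm ?subr_ge0 //.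
  apply: le_trans (xC i) _; have i0 : 0 <= i%:R :> R by rewrite ler0n.
  apply: ler_pM => //; rewrite ?invr_ge0; [lra|].
  by rewrite -(natr1 i) lef_pV2 ?posrE; lra.
have [G XG] := f_subgradient A b hlam X; have [C C0 xC] := rate W.
apply: (cluster_le XG) clX => e e0.
(* From such an [N] on, C / (i + 3) <= e. *)
have [N _ CN] : \forall i \near \oo, C / e <= i%:R by exact: nbhs_infty_ger.
exists N.+1 => // -[//|i] /= Ni; apply: le_trans (prox_le Ab0 xpP i.+1) _.
have Ci := CN i Ni; have i0 : 0 <= i%:R :> R by rewrite ler0n.
suff : C / (i%:R + 3) <= e by have := xC i; lra.
have i3 : 0 < i%:R + 3 :> R by lra.
by rewrite ler_pdivrMr // mulrC -ler_pdivrMr //; lra.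
Qed.
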